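(* Let $S\subset\mathbb{R}^2$ be an unbounded Lebesgue measurable set of positive Lebesgue measure. Then $S$ contains the three vertices of an isosceles triangle of area $1$. Also, $S$ contains the three vertices of a right-angled triangle of area $1$.
   Context: Lebesgue measure on $\mathbb{R}^2$ is the two-dimensional Lebesgue measure, and $\mathbb{R}^2$ carries the Euclidean metric. The measure of $S$ may be finite or infinite. *)

(* Defs.v *)
From HB Require Import structures.
From mathcomp Require Import all_boot all_order all_algebra.
From mathcomp Require Import all_classical all_reals all_analysis.

Set Implicit Arguments.
Unset Strict Implicit.
Unset Printing Implicit Defensive.

Import Order.TTheory GRing.Theory Num.Theory.
Import numFieldNormedType.Exports.

Local Open Scope classical_set_scope.
Local Open Scope ring_scope.

(* The library's product measure lives on the Borel sigma-algebra of the plane;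
   its Caratheodory extension is complete, so the measurable sets are all the
   Lebesgue measurable sets, not merely the Borel ones. *)
Definition borel_lebesgue2 (R : realType) :
    {measure set (measurableTypeR R * measurableTypeR R) -> \bar R} :=
  (@lebesgue_measure R \x @lebesgue_measure R)%E.

Definition lebesgue_measurable2 (R : realType) : set (set (R * R)) :=
  (borel_lebesgue2 R)^*%mu.-cara.-measurable.

Definition lebesgue_measure2 (R : realType) : set (R * R) -> \bar R :=
  @completed_measure_extension _ _ _ (borel_lebesgue2 R).

(* The library's norm on [R * R] is the sup norm, so the Euclidean metric is
   introduced separately. *)
Definition edist (R : realType) (p q : R * R) : R :=
  Num.sqrt ((p.1 - q.1) ^+ 2 + (p.2 - q.2) ^+ 2).

Definition ebounded (R : realType) (S : set (R * R)) : Prop :=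
  exists (c : R * R) (r : R), forall p, S p -> edist c p <= r.

Definition dot (R : realType) (u v : R * R) : R := u.1 * v.1 + u.2 * v.2.

Definition cross (R : realType) (u v : R * R) : R := u.1 * v.2 - u.2 * v.1.

(* Half the area of the parallelogram spanned by two sides. *)
Definition triangle_area (R : realType) (a b c : R * R) : R :=
  `|cross (b - a) (c - a)| / 2.

(* Nondegenerate triangles: the vertices are not collinear. *)
Definition is_triangle (R : realType) (a b c : R * R) : Prop :=
  cross (b - a) (c - a) <> 0.

(* At least two sides have equal length; equilateral triangles count. *)
Definition isosceles_triangle (R : realType) (a b c : R * R) : Prop :=
  is_triangle a b c /\
  (edist a b = edist a c \/ edist b a = edist b c \/ edist c a = edist c b).

Definition right_triangle (R : realType) (a b c : R * R) : Prop :=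
  is_triangle a b c /\
  (dot (b - a) (c - a) = 0 \/ dot (a - b) (c - b) = 0 \/
   dot (a - c) (b - c) = 0).

(* Main.v *)
Require Import Defs.
From mathcomp Require Import all_boot all_order all_algebra.
From mathcomp Require Import all_classical all_reals all_analysis.
From mathcomp Require Import ring lra.

Set Implicit Arguments.
Unset Strict Implicit.
Unset Printing Implicit Defensive.

Import Order.TTheory GRing.Theory Num.Theory.
Import numFieldNormedType.Exports.

Local Open Scope classical_set_scope.
Local Open Scope ring_scope.

(** The idea is to join two points of a bounded region to one very distant point of
[S].  Write [J] for the quarter turn and, for a point [p] of [S], put
[w m = J (p - m) / |p - m|^2].  The vector [w m] is orthogonal to [p - m] and
[|w m| * |p - m| = 1], so for every [m <> p]
- the points [p], [m - w m], [m + w m] form a triangle of area 1 that is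
  isosceles at [p], because [m] is the foot of its height from [p];
- the points [m], [p], [m + 2 w m] form a triangle of area 1 with a right angle
  at [m].
It remains to find [m] such that [m - w m] and [m + w m], respectively [m] and
[m + 2 w m], lie in [S].

The map [w] is an inversion up to isometry, whence
[|w x - w y| = |x - y| / (|p - x| |p - y|)].  So, as [p] goes to infinity, the
displacements of the maps [m |-> m + t w m] tend to zero on every bounded set,
uniformly and together with their Lipschitz constants ([nearly_identity_offset]).  Since [S] is
unbounded, [p] may be chosen as far away as desired.

The measure-theoretic heart is [nearly_identity_return]: a set of positive
measure has a point sent back into the set by both of two given maps that are
close enough to the identity, in the manner of the Steinhaus theorem.  Squeeze a
compact [K] and an open [U] around a bounded Borel part of [S] so that [U \ K]
is much smaller than [K] ([compact_core]).  Maps close to the identity send [K]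
into [U]; if no point returned to [K] under both, then [K] would be covered by
the preimages of [V = U \ K] under the two maps.  The maps shrink distances by a
factor 2 at most, so such a preimage has at most 16 times the measure of [V]:
this crude form of the change of variables formula is read off a grid of squares
([expansive_cover]).  That contradicts the choice of [U] and [K]. *)

(** The copy of [R * R] whose measurable sets are the Borel sets of the plane. *)
Notation plane R := (measurableTypeR R * measurableTypeR R)%type.

(** * Regularity of finite Borel measures on the plane *)

Lemma continuous_abscissa (R : realType) :
  continuous (fun p : plane R => p.1 : R).
Proof. by move=> x B /= xB; exact: (cvg_fst xB). Qed.

Lemma continuous_ordinate (R : realType) :
  continuous (fun p : plane R => p.2 : R).
Proof. by move=> x B /= xB; exact: (cvg_snd xB). Qed.

Section regularity.
Context (R : realType) (m : {measure set (plane R) -> \bar R}).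
Context (mfin : (m setT < +oo)%E).

(** Both bounds are asked to be measurable as well, so that [m] can be applied to
them without comparing the Borel sets of the product with the product of the
Borel sets. *)
Definition squeezable (A : set (plane R)) := forall e : R, 0 < e ->
  exists C U : set (plane R), [/\ closed C, open U, measurable C & measurable U] /\
    [/\ C `<=` A, A `<=` U & (m (U `\` C) < e%:E)%E].

Lemma squeezableC A : squeezable A -> squeezable (~` A).
Proof.
move=> rA e e0; have [C [U [[cC oU mC mU] [CA AU UC]]]] := rA e e0.
exists (~` U), (~` C); split; first split.
- exact: open_closedC.
- exact: closed_openC.
- exact: measurableC.
- exact: measurableC.
- by split; [exact: subsetC|exact: subsetC|rewrite setDE setCK setIC -setDE].
Qed.

Lemma measure_fin (A : set (plane R)) : measurable A -> (m A < +oo)%E.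
Proof. by move=> mA; rewrite (le_lt_trans _ mfin)// le_measure ?inE. Qed.

Lemma nonincreasing_measure_lt (F : (set (plane R))^nat) (e : R) :
  (forall n, measurable (F n)) -> nonincreasing_seq F ->
  (m (\bigcap_n F n) < e%:E)%E -> exists n, (m (F n) < e%:E)%E.
Proof.
move=> mF niF mFe.
have cF := nonincreasing_cvg_mu (measure_fin (mF 0%N)) mF
  (bigcapT_measurable mF) niF.
have [N _ /(_ N (leqnn N)) ?] := cF _ (open_ereal_lt' mFe).
by exists N.
Qed.

(** The union of the inner closed sets need not be closed, but a finite part of it
already fills it up to an arbitrarily small measure. *)
Lemma squeezable_bigcup (A : (set (plane R))^nat) :
  (forall n, squeezable (A n)) -> squeezable (\bigcup_n A n).
Proof.
move=> rA e e0.
have e20 : 0 < e / 2 by rewrite divr_gt0.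
have /choice[C /choice[U CU]] : forall n, exists C U : set (plane R),
    [/\ closed C, open U, measurable C & measurable U] /\
    [/\ C `<=` A n, A n `<=` U &
       (m (U `\` C) < (e / 2 / (2 ^ n.+1)%:R)%:E)%E ].
  by move=> n; apply: rA; rewrite divr_gt0// ltr0n expn_gt0.
have mU n : measurable (U n) by have [[]] := CU n.
have mC n : measurable (C n) by have [[]] := CU n.
have mUU : measurable (\bigcup_n U n) by exact: bigcupT_measurable.
pose D n := \bigcup_k U k `\` \big[setU/set0]_(i < n) C i.
have mD n : measurable (D n).
  by apply: measurableD => //; apply: bigsetU_measurable.
have [] := @nonincreasing_measure_lt D e mD.
- move=> i j ij; apply/subsetPset; apply: setDS.
  exact: subset_bigsetU.
- have -> : \bigcap_n D n = \bigcup_n U n `\` \bigcup_n C n.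
    rewrite eqEsubset; split=> [x Dx|x [Ux nCx] n _].
      split=> [|[n _ Cx]]; first by have [] := Dx 0%N I.
      by have [_] := Dx n.+1 I; apply; rewrite big_ord_recr; right.
    by split=> // Cx; apply: nCx; exact: bigsetU_bigcup Cx.
  have UCsub : \bigcup_n U n `\` \bigcup_n C n `<=` \bigcup_n (U n `\` C n).
    by move=> x [[n _ Ux] nC]; exists n => //; split=> // Cx; apply: nC; exists n.
  apply: (@le_lt_trans _ _ (e / 2)%:E); last by rewrite lte_fin; lra.
  apply: (le_trans _ (epsilon_trick0 xpredT (ltW e20))).
  apply: (le_trans (measure_sigma_subadditive m _ _ UCsub)).
  + by move=> n; exact: measurableD.
  + by apply: measurableD => //; exact: bigcupT_measurable.
  + apply: lee_nneseries => // n _.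
    by apply: ltW; have [_ []] := CU n.
- move=> N DN; exists (\big[setU/set0]_(i < N) C i), (\bigcup_n U n).
  split; first split => //.
  + by apply: closed_bigsetU => i _; have [[]] := CU i.
  + by apply: bigcup_open => i _; have [[]] := CU i.
  + exact: bigsetU_measurable.
  + split => //.
    * apply: (@subset_trans _ (\bigcup_i C i)); first exact: bigsetU_bigcup.
      move=> x [n _ Cx]; exists n => //.
      by have [_ [CA _ _]] := CU n; exact: CA.
    * by apply: subset_bigcup => i _; have [_ []] := CU i.
Qed.

(** The rays [f >= x + 1/(n+1)] are closed and exhaust the open ray [f > x]. *)
Lemma squeezable_open_ray (f : plane R -> R) (x : R) : continuous f ->
  measurable_fun setT f -> squeezable (f @^-1` `]x, +oo[).
Proof.
move=> cf mf e e0.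
have mfp (i : interval R) : measurable (f @^-1` [set` i]).
  by rewrite -[_ @^-1` _]setTI; exact: mf.
pose D n := f @^-1` `]x, x + n.+1%:R^-1[.
have [] := @nonincreasing_measure_lt D e.
- by move=> n; exact: mfp.
- move=> i j ij; apply/subsetPset => p; rewrite /D /= !in_itv /= => /andP[->] /=.
  by move=> /lt_le_trans; apply; rewrite lerD2l lef_pV2 ?posrE// ler_nat.
- suff -> : \bigcap_n D n = set0 by rewrite measure0 lte_fin.
  rewrite -subset0 => p Dp /=.
  have := Dp 0%N I; rewrite /D /= in_itv /= => /andP[xf _].
  (* by the Archimedean property, some [1/(n+1)] is below [f p - x] *)
  have := Dp (Num.bound (f p - x)^-1) I; rewrite /D /= in_itv /= => /andP[_].
  rewrite -ltrBlDl; apply/negP; rewrite -leNgt.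
  rewrite invf_ple ?posrE ?subr_gt0//.
  have := archi_boundP (ltW (_ : 0 < (f p - x)^-1)).
  rewrite invr_gt0 subr_gt0 => /(_ xf) /ltW /le_trans; apply.
  by rewrite ler_nat.
- move=> n Dn; exists (f @^-1` `[x + n.+1%:R^-1, +oo[), (f @^-1` `]x, +oo[).
  split; first split => //.
  + by apply: preimage_closed => [? _|]; [exact: cf|exact: interval_closed].
  + by apply: open_comp => [? _|]; [exact: cf|exact: interval_open].
  + split => //.
      move=> p /=; rewrite !in_itv /= !andbT; apply: lt_le_trans.
      by rewrite ltrDl invr_gt0 ltr0n.
    suff -> : f @^-1` `]x, +oo[ `\` f @^-1` `[x + n.+1%:R^-1, +oo[ = D n by [].
    rewrite eqEsubset /D; split=> p /=; rewrite !in_itv /= !andbT.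
      by move=> [-> /negP]; rewrite -ltNge.
    by move=> /andP[-> fp]; split=> //; apply/negP; rewrite -ltNge.
Qed.

Lemma squeezable_sigma_algebra : sigma_algebra setT squeezable.
Proof.
split => //.
- move=> e e0; exists set0, set0; split.
    by split; [exact: closed0|exact: open0|exact: measurable0|exact: measurable0].
  by split => //; rewrite setD0 measure0 lte_fin.
- by move=> A; rewrite setTD; exact: squeezableC.
- exact: squeezable_bigcup.
Qed.

Lemma squeezable_preimage (f : plane R -> R) (B : set (measurableTypeR R)) :
  continuous f -> measurable_fun setT f -> measurable B ->
  squeezable (f @^-1` B).
Proof.
move=> cf mf; rewrite measurable_realfun.RGenOInfty.measurableE => mB.
have -> : f @^-1` B = setT `&` f @^-1` B by rewrite setTI.
suff: <<s @measurable_realfun.RGenOInfty.G R >> `<=`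
    image_set_system setT f squeezable by exact.
apply: smallest_sub.
  exact: sigma_algebra_image squeezable_sigma_algebra.
by move=> _ [x ->]; rewrite /image_set_system /= setTI; exact: squeezable_open_ray.
Qed.

(** The squeezable sets form a sigma-algebra, and the product sigma-algebra is
generated by preimages of rays under the two coordinates. *)
Lemma measurable_squeezable (A : set (plane R)) : measurable A -> squeezable A.
Proof.
have m1 : measurable_fun setT (fun p : plane R => p.1 : R).
  exact: (@measurable_fst _ _ (measurableTypeR R) (measurableTypeR R)).
have m2 : measurable_fun setT (fun p : plane R => p.2 : R).
  exact: (@measurable_snd _ _ (measurableTypeR R) (measurableTypeR R)).
apply: smallest_sub; first exact: squeezable_sigma_algebra.
rewrite subUset; split=> _ [B mB <-]; rewrite setTI.
- exact: (squeezable_preimage (@continuous_abscissa R) m1 mB).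
- exact: (squeezable_preimage (@continuous_ordinate R) m2 mB).
Qed.

End regularity.

(** * A compact core of a set of positive measure *)

Section compact_core.
Context (R : realType).
Let mu := borel_lebesgue2 R.

Definition open_box (r : R) : set (plane R) := `]- r, r[ `*` `]- r, r[.

Lemma measurable_open_box r : measurable (open_box r).
Proof. by apply: measurableX; exact: measurable_itv. Qed.

Lemma borel_lebesgue2_rectangle (A B : set (measurableTypeR R)) :
  measurable A -> measurable B ->
  mu (A `*` B) = (lebesgue_measure A * lebesgue_measure B)%E.
Proof. exact: product_measure1E. Qed.

Lemma open_box_fin r : (mu (open_box r) < +oo)%E.
Proof.
rewrite borel_lebesgue2_rectangle//.
by rewrite !lebesgue_measure_itv/= -!EFinD; case: ifP => _;
  rewrite ?mule0 // -EFinM ltry.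
Qed.

Lemma open_box_exhausts (p : plane R) : exists n : nat, open_box n%:R p.
Proof.
exists (maxn (Num.bound `|p.1|) (Num.bound `|p.2|)).
split; rewrite /= in_itv /= -ltr_norml (lt_le_trans (archi_boundP (normr_ge0 _)))//.
  by rewrite ler_nat leq_maxl.
by rewrite ler_nat leq_maxr.
Qed.

(** Covering the complement of [S] in a large box by a Borel set of almost the same
outer measure leaves over a Borel part of [S]; the Caratheodory criterion for
[S] makes the two outer measures add up to the measure of the box. *)
Lemma bounded_borel_core (S : set (plane R)) :
  lebesgue_measurable2 S -> (0 < lebesgue_measure2 S)%E ->
  exists (r : R) (A : set (plane R)),
    [/\ measurable A, A `<=` S, A `<=` open_box r & (0 < mu A)%E].
Proof.
move=> mS S0.
pose nu : {outer_measure set (plane R) -> \bar R} := mu^*%mu.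
have [n Sn0] : exists n : nat, (0 < mu^*%mu (S `&` open_box n%:R))%E.
  apply: contrapT => /forallNP Sn0.
  suff : (nu S <= 0)%E by rewrite leNgt S0.
  have Ssub : S `<=` \bigcup_n (S `&` open_box n%:R).
    by move=> p Sp; have [n ?] := open_box_exhausts p; exists n.
  apply: (le_trans (le_outer_measure nu _ _ Ssub)).
  apply: (le_trans (outer_measure_sigma_subadditive nu _)).
  rewrite eseries0// => n _ _; apply/eqP; rewrite eq_le outer_measure_ge0 andbT.
  by rewrite leNgt; apply/negP/Sn0.
pose B := open_box n%:R.
have mB : measurable B := measurable_open_box _.
have muB : mu^*%mu B = mu B := measurable_mu_extE _ mB.
have BS : mu^*%mu B = (mu^*%mu (B `&` S) + mu^*%mu (B `&` ~` S))%E := mS B.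
have EB : (mu^*%mu (B `&` ~` S) < +oo)%E.
  by rewrite (le_lt_trans _ (open_box_fin n%:R))// -muB le_outer_measure.
have /ereal_inf_lt[_ [F [mF BSF] <-] Flt] :
    (mu^*%mu (B `&` ~` S) < mu B)%E.
  by rewrite -muB BS addeC lteDl// ?ge0_fin_numE ?outer_measure_ge0// setIC.
exists n%:R, (B `\` \bigcup_k F k).
have mUF : measurable (\bigcup_k F k) by exact: bigcupT_measurable.
have mA : measurable (B `\` \bigcup_k F k) by exact: measurableD.
split => //.
- move=> p [Bp nFp]; apply: contrapT => nSp; exact/nFp/BSF.
- rewrite lt0e measure_ge0 andbT; apply/eqP => A0.
  have : (mu B <= mu (B `\` \bigcup_k F k) + mu (\bigcup_k F k))%E.
    rewrite (le_trans _ (measureU2 mu mA mUF))// le_measure ?inE//.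
      exact: measurableU.
    by move=> p Bp; have [|] := pselect ((\bigcup_k F k) p); [right|left].
  rewrite A0 add0e; apply/negP; rewrite -ltNge.
  apply: le_lt_trans Flt.
  exact: (measure_sigma_subadditive mu mF mUF).
Qed.

(** The factor 32 is twice the constant of [expansive_cover], one for each of the two
maps of [nearly_identity_return]. *)
Lemma compact_core (S : set (plane R)) :
  lebesgue_measurable2 S -> (0 < lebesgue_measure2 S)%E ->
  exists (r : R) (K U : set (plane R)),
    [/\ compact K, closed K, measurable K, open U & measurable U] /\
    [/\ K `<=` S, K `<=` U, U `<=` open_box r, (mu K < +oo)%E
      & (32%:E * mu (U `\` K) < mu K)%E].
Proof.
move=> mS S0; have [r [A [mA AS Ar A0]]] := bounded_borel_core mS S0.
have mB : measurable (open_box r) := measurable_open_box r.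
pose m := mrestr mu mB.
have mfin : (m setT < +oo)%E by rewrite /m /mrestr setTI open_box_fin.
have finA X : X `<=` open_box r -> measurable X -> mu X \is a fin_num.
  move=> Xr mX; rewrite ge0_fin_numE// (le_lt_trans _ (open_box_fin r))//.
  by rewrite le_measure ?inE.
(* [mu A <= mu K + mu (U \ K)], so [mu (U \ K) < mu A / 33] suffices *)
pose e : R := fine (mu A) / 33.
have e0 : 0 < e by rewrite divr_gt0// fine_gt0// A0 -ge0_fin_numE// finA.
have [K [U [[cK oU mK mU] [KA AU UK]]]] := measurable_squeezable mfin mA e0.
exists r, K, (U `&` open_box r).
have oB : open (open_box r).
  have -> : open_box r = (fun p : plane R => p.1 : R) @^-1` `]- r, r[ `&`
      (fun p : plane R => p.2 : R) @^-1` `]- r, r[ by [].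
  by apply: openI; apply: open_comp => [p _|];
    [exact: continuous_abscissa|exact: interval_open|
     exact: continuous_ordinate|exact: interval_open].
have KB : K `<=` open_box r by move=> p /KA /Ar.
split; split => //.
- apply: (@subclosed_compact _ _ (`[- r, r] `*` `[- r, r])) => //.
    by apply: compact_setX; exact: segment_compact.
  by move=> p /KB [p1 p2]; split; [move: p1|move: p2]; exact: subset_itvW.
- exact: openI.
- exact: measurableI.
- by move=> p /KA /AS.
- by move=> p Kp; split; [exact/AU/KA|exact: KB].
- by move: (finA _ KB mK); rewrite ge0_fin_numE.
- set V := _ `\` K.
  have VE : V = (U `\` K) `&` open_box r by rewrite /V !setDE setIAC.
  have mV : measurable V by rewrite VE; apply: measurableI => //; exact: measurableD.
  have Ve : (mu V < e%:E)%E by rewrite VE.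
  have AKV : (mu A <= mu K + mu V)%E.
    rewrite (le_trans _ (measureU2 mu mK mV))// le_measure ?inE//.
      exact: measurableU.
    move=> p Ap; have [Kp|nKp] := pselect (K p); [by left|right].
    by split => //; split; [exact: AU|exact: Ar].
  have fA := finA _ Ar mA; have fK := finA _ KB mK.
  have fV : mu V \is a fin_num by apply: finA => //; rewrite VE => p [].
  move: Ve AKV; rewrite /e -(fineK fA) -(fineK fK) -(fineK fV) /=.
  rewrite -EFinD -EFinM !lte_fin lee_fin => Ve AKV; lra.
Qed.

End compact_core.

(** * Preimages under expansive maps *)

Section covering.
Context (R : realType).
Let mu := borel_lebesgue2 R.

Lemma borel_lebesgue2_square (a b s : R) : 0 < s ->
  mu (`[a, a + s[ `*` `[b, b + s[) = (s ^+ 2)%:E.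
Proof.
move=> s0; rewrite borel_lebesgue2_rectangle//.
rewrite !lebesgue_measure_itv/= !lte_fin !ltrDl s0 -!EFinB -EFinM.
by congr (_%:E); ring.
Qed.

Definition grid_cell (s : R) (i : int * int) : set (plane R) :=
  `[i.1%:~R * s, i.1%:~R * s + s[ `*` `[i.2%:~R * s, i.2%:~R * s + s[.

Lemma measurable_square (a b c d : R) :
  measurable (`[a, b[ `*` `[c, d[ : set (plane R)).
Proof. by apply: measurableX; exact: measurable_itv. Qed.

Lemma grid_cell_floor (s : R) i p : 0 < s ->
  grid_cell s i p <-> i = (Num.floor (p.1 / s), Num.floor (p.2 / s)).
Proof.
have H (k : int) (x : R) : 0 < s ->
    (x \in `[k%:~R * s, k%:~R * s + s[) = (Num.floor (x / s) == k).
  move=> s0; rewrite in_itv /= -(ler_pdivlMr _ _ s0).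
  have -> : k%:~R * s + s = (k + 1)%:~R * s by rewrite intrD; ring.
  by rewrite -(ltr_pdivrMr _ _ s0) floor_eq.
move=> s0; case: i => i j; split => [[]/=|[-> ->]].
  by rewrite !H// => /eqP -> /eqP ->.
by split; rewrite /= H.
Qed.

Lemma grid_cell_near (s : R) i (p q : R * R) :
  grid_cell s i p -> grid_cell s i q -> `|p - q| < s.
Proof.
move=> [+ +] [+ +]; rewrite /= !in_itv /= => /andP[? ?] /andP[? ?] /andP[? ?] /andP[? ?].
by rewrite prod_normE gt_max /= !ltr_norml; apply/andP; split; apply/andP; split; lra.
Qed.

(** Cut the plane into half-open squares of side [s].  A square that meets [F @` B]
lies in [V], and its preimage in [B] has diameter below [2 * s], hence fits into a
square of side [4 * s] around any of its points.  The squares are disjoint, so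
summing loses no more than the factor 16 between the areas. *)
Lemma expansive_cover (V : set (plane R)) (B : set (R * R))
    (F : R * R -> R * R) (s : R) :
  0 < s -> measurable V ->
  (forall p q, B p -> `|F p - q| < s -> V q) ->
  (forall p q, B p -> B q -> `|p - q| <= 2 * `|F p - F q|) ->
  exists W : set (plane R),
    [/\ measurable W, B `<=` W & (mu W <= 16%:E * mu V)%E].
Proof.
move=> s0 mV FV Fexp.
(* [pickle_inv] rather than [unpickle], whose repeated values would list cells twice *)
pose Q n := if @pickle_inv (int * int)%type n is Some i then grid_cell s i else set0.
have tQ : trivIset setT Q.
  move=> m n _ _ [x []]; rewrite /Q.
  case Em : (@pickle_inv (int * int)%type m) => [i|//].
  case En : (@pickle_inv (int * int)%type n) => [j|//].
  move=> /(grid_cell_floor _ _ s0) ij /(grid_cell_floor _ _ s0); rewrite -ij => ji.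
  have := @pickle_invK (int * int)%type m; have := @pickle_invK (int * int)%type n.
  by rewrite Em En /= ji => -> ->.
have /choice[W /choice[P WP]] : forall n, exists W P : set (plane R),
    [/\ measurable W, measurable P & (mu W <= 16%:E * mu P)%E] /\
    [/\ P `<=` V, P `<=` Q n & forall p, B p -> Q n (F p) -> W p].
  move=> n.
  have [[p [Bp Qp]]|nQ] := pselect (exists p, B p /\ Q n (F p)); last first.
    exists set0, set0; split; split => //.
      by rewrite measure0 mule0.
    by move=> p Bp Qp; apply: nQ; exists p.
  move: Qp; rewrite /Q; case: (@pickle_inv (int * int)%type n) => [i Qp|//].
  exists (`[p.1 - 2 * s, p.1 - 2 * s + 4 * s[ `*`
          `[p.2 - 2 * s, p.2 - 2 * s + 4 * s[), (grid_cell s i).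
  split; split.
  - exact: measurable_square.
  - exact: measurable_square.
  - rewrite /grid_cell !borel_lebesgue2_square ?mulr_gt0//.
    by rewrite -EFinM lee_fin; lra.
  - by move=> q Qq; apply: (FV p) => //; exact: grid_cell_near Qq.
  - by [].
  - move=> q Bq Qq.
    have : `|p - q| < 2 * s.
      by rewrite (le_lt_trans (Fexp _ _ Bp Bq))// ltr_pM2l// (grid_cell_near Qp).
    rewrite prod_normE gt_max /= !ltr_norml => /andP[/andP[? ?] /andP[? ?]].
    by split; rewrite /= in_itv /=; apply/andP; split; lra.
exists (\bigcup_n W n).
have mW n : measurable (W n) by have [[]] := WP n.
have mP n : measurable (P n) by have [[]] := WP n.
have tP : trivIset setT P.
  move=> i j _ _ [x [Pi Pj]]; apply: tQ => //; exists x.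
  by split; [have [_ [_ + _]] := WP i|have [_ [_ + _]] := WP j]; apply.
split.
- exact: bigcupT_measurable.
- move=> p Bp; pose i := (Num.floor ((F p).1 / s), Num.floor ((F p).2 / s)).
  exists (pickle i); first exact: I.
  have [_ [_ _]] := WP (pickle i); apply; first exact: Bp.
  by rewrite /Q pickleK_inv; exact/grid_cell_floor.
- have UPV : \bigcup_n P n `<=` V.
    by apply: bigcup_sub => n _; have [_ []] := WP n.
  have mUP : measurable (\bigcup_n P n) by exact: bigcupT_measurable.
  apply: (@le_trans _ _ (16%:E * mu (\bigcup_n P n))%E); last first.
    by rewrite lee_pmul2l// le_measure ?inE.
  have -> : mu (\bigcup_n P n) = (\sum_(n <oo) mu (P n))%E.
    exact: measure_semi_bigcup.
  have <- : (\sum_(n <oo) 16%:E * mu (P n) = 16%:E * \sum_(n <oo) mu (P n))%E.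
    by apply: nneseriesZl => n _; exact: measure_ge0.
  apply: (@le_trans _ _ (\sum_(n <oo) mu (W n))%E).
    apply: (measure_sigma_subadditive mu mW) => //; exact: bigcupT_measurable.
  apply: lee_nneseries => n _; first by move=> _; exact: measure_ge0.
  by have [[]] := WP n.
Qed.

End covering.

(** * Return of points under maps close to the identity *)

Section near_identity.
Context (R : realType).
Let mu := borel_lebesgue2 R.

(** A Lebesgue number argument.  With [F = G = id] it says that [K] has a uniform
neighbourhood inside [V]; in general it provides the mesh of the grid of
[expansive_cover]. *)
Lemma uniform_ball (K V : set (R * R)) (F G : R * R -> R * R) :
  compact K -> open V ->
  (forall p q, K p -> K q -> `|F p - F q| <= 2 * `|p - q|) ->
  (forall p q, K p -> K q -> `|G p - G q| <= 2 * `|p - q|) ->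
  (forall p, K p -> V (F p) \/ V (G p)) ->
  exists2 s : R, 0 < s & forall p, K p ->
    (forall q, `|F p - q| < s -> V q) \/ (forall q, `|G p - q| < s -> V q).
Proof.
move=> cK oV LF LG KV.
pose P (s : R) p := K p ->
  (forall q, `|F p - q| < s -> V q) \/ (forall q, `|G p - q| < s -> V q).
have ballV (H : R * R -> R * R) p :
    (forall p q, K p -> K q -> `|H p - H q| <= 2 * `|p - q|) -> K p ->
    V (H p) -> exists2 d : R, 0 < d & forall p' s, K p' -> `|p - p'| < d ->
      s < d -> forall q, `|H p' - q| < s -> V q.
  move=> LH Kp VHp.
  have /nbhs_ballP[d /= d0 dV] : nbhs (H p) V by exact: open_nbhs_nbhs.
  exists (d / 3); first by rewrite divr_gt0.
  move=> p' s Kp' pp' sd q qs; apply: dV; rewrite -ball_normE /=.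
  rewrite (le_lt_trans (ler_distD (H p') _ _))//.
  have := LH _ _ Kp Kp'; lra.
have nearP : \forall s \near (0:R)^'+, K `<=` P s.
  apply: (iffLR (compact_near_coveringP K) cK _ _ P) => p Kp.
  have [d d0 dP] : exists2 d : R, 0 < d & forall p' s, `|p - p'| < d ->
      s < d -> P s p'.
    have [/(ballV _ _ LF Kp)|/(ballV _ _ LG Kp)] := KV p Kp => -[d d0 dV];
      exists d => // p' s pp' sd Kp'; [left|right]; exact: dV pp' sd.
  exists ([set p' | `|p - p'| < d], [set s | s < d]).
    split; last exact: nbhs_right_lt.
    by apply/nbhs_ballP; exists d => //= q; rewrite -ball_normE.
  by move=> [p' s] [/= pp' sd]; exact: dP.
near (0:R)^'+ => s; exists s.
  by near: s; exact: nbhs_right_gt.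
have KP : K `<=` P s by near: s; exact: nearP.
by move=> p Kp; exact: KP.
Unshelve. all: by end_near. Qed.

Lemma displacement_split (V : zmodType) (p q a b : V) :
  a - b = (p - q) + ((a - p) - (b - q)).
Proof. by rewrite opprB addrACA addKr subrKC. Qed.

(** Closeness to the identity in the C^1 sense, without derivatives; the norm is the
sup norm. *)
Definition nearly_identity (B : set (plane R)) (eta : R) (F : R * R -> R * R) :=
  (forall p, B p -> `|p - F p| < eta) /\
  (forall p q, B p -> B q -> `|(F p - p) - (F q - q)| <= `|p - q| / 2).

Lemma nearly_identity_lipschitz B eta F p q : nearly_identity B eta F ->
  B p -> B q -> `|F p - F q| <= 2 * `|p - q|.
Proof.
move=> [_ LF] Bp Bq; have := LF _ _ Bp Bq.
have -> : F p - F q = (p - q) + (F p - p - (F q - q)).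
  exact: displacement_split.
move=> h; rewrite (le_trans (ler_normD _ _))//.
by have := normr_ge0 (p - q); lra.
Qed.

Lemma nearly_identity_expansive B eta F p q : nearly_identity B eta F ->
  B p -> B q -> `|p - q| <= 2 * `|F p - F q|.
Proof.
move=> [_ LF] Bp Bq; have := LF _ _ Bp Bq.
have := ler_normB (F p - F q) ((F p - p) - (F q - q)).
have -> : F p - F q - (F p - p - (F q - q)) = p - q.
  by rewrite [F p - F q](displacement_split p q) addrK.
move=> h1 h2; lra.
Qed.

(** A two-map form of the Steinhaus theorem.  The isosceles triangle needs both maps;
the right triangle takes one of them to be the identity. *)
Lemma nearly_identity_return (S : set (plane R)) :
  lebesgue_measurable2 S -> (0 < lebesgue_measure2 S)%E ->
  exists r eta : R, 0 < eta /\ forall F G : R * R -> R * R,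
    nearly_identity (open_box r) eta F -> nearly_identity (open_box r) eta G ->
    exists p, [/\ open_box r p, S (F p) & S (G p)].
Proof.
move=> mS S0.
have [r [K [U [[cK clK mK oU mU] [KS KU Ur Kfin UK]]]]] := compact_core mS S0.
have [eta eta0 etaU] : exists2 eta : R, 0 < eta &
    forall p, K p -> forall q, `|p - q| < eta -> U q.
  have idL p q : K p -> K q -> `|p - q| <= 2 * `|p - q|.
    by move=> _ _; have := normr_ge0 (p - q); lra.
  have [|eta eta0 etaU] := uniform_ball cK oU idL idL.
    by move=> p /KU; left.
  by exists eta => // p /etaU [].
exists r, eta; split=> // F G nF nG.
have Kr p : K p -> open_box r p by move=> /KU /Ur.
suff [p [Kp KF KG]] : exists p, [/\ K p, K (F p) & K (G p)].
  by exists p; split; [exact: Kr|exact: KS|exact: KS].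
apply: contrapT => noK.
pose V := U `\` K.
have oV : open V.
  by apply: openI => //; exact: closed_openC.
have mV : measurable (V : set (plane R)) by exact: measurableD.
have FGV p : K p -> V (F p) \/ V (G p).
  move=> Kp; have UF : U (F p) by apply: etaU (Kp) _ _; apply: nF.1; exact: Kr.
  have UG : U (G p) by apply: etaU (Kp) _ _; apply: nG.1; exact: Kr.
  have [KF|nKF] := pselect (K (F p)); last by left.
  by right; split => // KG; apply: noK; exists p.
have [||s s0 sV] := uniform_ball cK oV _ _ FGV.
- by move=> p q /Kr Kp /Kr Kq; exact: nearly_identity_lipschitz nF Kp Kq.
- by move=> p q /Kr Kp /Kr Kq; exact: nearly_identity_lipschitz nG Kp Kq.
have cover H : nearly_identity (open_box r) eta H ->
    exists W : set (plane R), [/\ measurable W,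
      K `&` [set p | forall q, `|H p - q| < s -> V q] `<=` W
      & (mu W <= 16%:E * mu V)%E].
  move=> nH; apply: (expansive_cover (F := H) s0 mV).
  - by move=> p q [_ +]; exact.
  - by move=> p q [/Kr Kp _] [/Kr Kq _]; exact: nearly_identity_expansive nH Kp Kq.
have [W1 [mW1 KW1 W1V]] := cover F nF.
have [W2 [mW2 KW2 W2V]] := cover G nG.
move: UK; apply/negP; rewrite -leNgt.
apply: (@le_trans _ _ (mu W1 + mu W2)%E).
  rewrite (le_trans _ (measureU2 mu mW1 mW2))// le_measure ?inE//.
    exact: measurableU.
  by move=> p Kp; have [?|?] := sV _ Kp; [left; apply: KW1|right; apply: KW2].
apply: (le_trans (leeD W1V W2V)); rewrite -ge0_muleDl//.
by rewrite -EFinD -natrD.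
Qed.
End near_identity.

(** * Offsets orthogonal to a distant point *)

Section offset.
Context (R : realType).

Definition dist_sq (p m : R * R) : R := (p.1 - m.1) ^+ 2 + (p.2 - m.2) ^+ 2.

(** The vector [t * J (p - m) / |p - m|^2], where [J] is the quarter turn. *)
Definition normal_offset (t : R) (p m : R * R) : R * R :=
  (- (t * (p.2 - m.2) / dist_sq p m), t * (p.1 - m.1) / dist_sq p m).

Lemma far_dist_sq (r M : R) (p m : R * R) : 0 <= M ->
  2 * (M + r) < Defs.edist 0 p -> open_box r m -> M ^+ 2 <= dist_sq p m.
Proof.
move=> M0 far [/= +  +]; rewrite !in_itv /= => /andP[rm1 m1r] /andP[rm2 m2r].
rewrite leNgt; apply/negP => small.
have lt_M (x y : R) : x ^+ 2 + y ^+ 2 < M ^+ 2 -> `|x| < M.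
  move=> h; rewrite -(ltr_pXn2r (n := 2)) ?nnegrE//.
  by rewrite real_normK ?num_real//; have := sqr_ge0 y; lra.
have d1 := lt_M _ _ small.
have d2 : `|p.2 - m.2| < M by apply: (lt_M _ (p.1 - m.1)); rewrite addrC.
have p1 : `|p.1| <= M + r.
  by move: d1; rewrite ltr_norml ler_norml => /andP[? ?]; apply/andP; split; lra.
have p2 : `|p.2| <= M + r.
  by move: d2; rewrite ltr_norml ler_norml => /andP[? ?]; apply/andP; split; lra.
move: far; apply/negP; rewrite -leNgt /Defs.edist /= !sub0r !sqrrN.
have Mr : 0 <= M + r by rewrite (le_trans _ p1).
have bound (x : R) : `|x| <= M + r -> x ^+ 2 <= (M + r) ^+ 2.
  by move=> h; rewrite -real_normK ?num_real// lerXn2r ?nnegrE.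
rewrite -[leRHS]ger0_norm ?mulr_ge0// -sqrtr_sqr ler_sqrt ?sqr_ge0//.
have := bound _ p1; have := bound _ p2; have := sqr_ge0 (M + r).
by rewrite exprMn; lra.
Qed.

Lemma normal_offset_small (t M : R) (p m : R * R) : 0 < M ->
  M ^+ 2 <= dist_sq p m -> `|normal_offset t p m| <= `|t| / M.
Proof.
move=> M0 far.
have U0 : 0 < dist_sq p m by rewrite (lt_le_trans _ far)// exprn_gt0.
have H (x y : R) : dist_sq p m = x ^+ 2 + y ^+ 2 ->
    `|t * x / dist_sq p m| <= `|t| / M.
  move=> E; rewrite 2!normrM -mulrA ler_wpM2l// normfV (gtr0_norm U0).
  rewrite ler_pdivrMr// ler_pdivlMl//.
  rewrite -(ler_pXn2r (n := 2)) ?nnegrE ?mulr_ge0 ?(ltW M0) ?(ltW U0)// exprMn.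
  rewrite real_normK ?num_real// [leRHS]expr2.
  apply: ler_pM => //; rewrite ?sqr_ge0 ?E//.
  by have := sqr_ge0 y; lra.
rewrite prod_normE ge_max /= normrN; apply/andP; split; apply: H.
  by rewrite /dist_sq addrC.
by [].
Qed.

(** Up to isometry and the factor [t], the offset is the inversion centred at [p],
which divides the distance of [x] and [y] by [|p - x| * |p - y|]. *)
Lemma normal_offset_lipschitz (t M : R) (p x y : R * R) :
  8 * t ^+ 2 <= M ^+ 4 ->
  0 < M -> M ^+ 2 <= dist_sq p x -> M ^+ 2 <= dist_sq p y ->
  `|normal_offset t p x - normal_offset t p y| <= `|x - y| / 2.
Proof.
move=> tM M0 farx fary.
have X0 : 0 < dist_sq p x by rewrite (lt_le_trans _ farx)// exprn_gt0.
have Y0 : 0 < dist_sq p y by rewrite (lt_le_trans _ fary)// exprn_gt0.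
set w := _ - normal_offset t p y.
have E : w.1 ^+ 2 + w.2 ^+ 2 =
    t ^+ 2 * dist_sq x y / (dist_sq p x * dist_sq p y).
  rewrite /w /normal_offset /=; move: X0 Y0; rewrite /dist_sq => X0 Y0.
  by field; rewrite !gt_eqF.
have XY : M ^+ 4 <= dist_sq p x * dist_sq p y.
  by rewrite (_ : 4%N = (2 + 2)%N)// exprD ler_pM// exprn_ge0// ltW.
have dxy : dist_sq x y <= 2 * `|x - y| ^+ 2.
  have H (z : R) : `|z| <= `|x - y| -> z ^+ 2 <= `|x - y| ^+ 2.
    by move=> h; rewrite -real_normK ?num_real// lerXn2r ?nnegrE.
  have h1 : (x.1 - y.1) ^+ 2 <= `|x - y| ^+ 2.
    by apply: H; rewrite prod_normE le_max lexx.
  have h2 : (x.2 - y.2) ^+ 2 <= `|x - y| ^+ 2.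
    by apply: H; rewrite [leRHS]prod_normE le_max lexx orbT.
  rewrite /dist_sq; lra.
have wle : w.1 ^+ 2 + w.2 ^+ 2 <= (`|x - y| / 2) ^+ 2.
  rewrite E ler_pdivrMr ?mulr_gt0// exprMn.
  have := sqr_ge0 t; have := sqr_ge0 `|x - y|; nra.
have H (z : R) : z ^+ 2 <= w.1 ^+ 2 + w.2 ^+ 2 -> `|z| <= `|x - y| / 2.
  move=> h; rewrite -(ler_pXn2r (n := 2)) ?nnegrE ?divr_ge0//.
  by rewrite real_normK ?num_real// (le_trans h).
by rewrite prod_normE ge_max; apply/andP; split; apply: H;
  [have := sqr_ge0 w.2|have := sqr_ge0 w.1]; lra.
Qed.

Lemma nearly_identity_offset (r eta t : R) : 0 < eta ->
  exists D : R, forall p, D < Defs.edist 0 p ->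
    nearly_identity (open_box r) eta (fun m => m + normal_offset t p m) /\
    forall m, open_box r m -> 0 < dist_sq p m.
Proof.
move=> eta0.
(* [M > |t| / eta] controls the displacement, [M >= 1 + 3 |t|] gives
   [8 t^2 <= M^4] *)
pose M := 1 + 3 * `|t| + `|t| / eta.
have te0 : 0 <= `|t| / eta by rewrite divr_ge0// ltW.
have M1 : 1 + 3 * `|t| <= M by rewrite lerDl.
have t0 := normr_ge0 t.
have M0 : 0 < M by lra.
exists (2 * (M + r)) => p far.
have farM m : open_box r m -> M ^+ 2 <= dist_sq p m.
  by apply: far_dist_sq far; exact: ltW.
split; last first.
  by move=> m /farM; apply: lt_le_trans; rewrite exprn_gt0.
split=> [m mr|x y xr yr].
  rewrite opprD addrA subrr sub0r normrN.
  rewrite (le_lt_trans (normal_offset_small t M0 (farM _ mr)))//.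
  rewrite ltr_pdivrMr// mulrC -ltr_pdivrMr// /M; lra.
have cancel z : z + normal_offset t p z - z = normal_offset t p z.
  by rewrite addrAC subrr add0r.
rewrite !cancel.
apply: (normal_offset_lipschitz _ M0 (farM _ xr) (farM _ yr)).
rewrite -[t ^+ 2]real_normK ?num_real//.
have : (1 + 3 * `|t|) ^+ 2 <= M ^+ 2 by rewrite lerXn2r ?nnegrE//; lra.
rewrite (_ : 4%N = (2 * 2)%N)// exprM; nra.
Qed.

End offset.

(** * The triangles *)

Section triangles.
Context (R : realType).

Lemma right_triangle_offset (p m : R * R) : 0 < dist_sq p m ->
  right_triangle m p (m + normal_offset 2 p m) /\
  triangle_area m p (m + normal_offset 2 p m) = 1.
Proof.
move=> d0.
have C : cross (p - m) (m + normal_offset 2 p m - m) = 2.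
  rewrite addrAC subrr add0r /cross /normal_offset /=.
  by move: d0; rewrite /dist_sq => d0; field; rewrite gt_eqF.
split; last by rewrite /triangle_area C normr_nat divff.
split; first by rewrite /is_triangle C; apply/eqP.
left; rewrite addrAC subrr add0r /dot /normal_offset /=; ring.
Qed.

(** The base is centred at [m] and orthogonal to [p - m], so the apex is [p]. *)
Lemma isosceles_triangle_offset (p m : R * R) : 0 < dist_sq p m ->
  let b := m + normal_offset (- 1) p m in let c := m + normal_offset 1 p m in
  isosceles_triangle p b c /\ triangle_area p b c = 1.
Proof.
move=> d0 b c.
have C : cross (b - p) (c - p) = - 2.
  rewrite /b /c /cross /normal_offset /=.
  by move: d0; rewrite /dist_sq => d0; field; rewrite gt_eqF.
split; last by rewrite /triangle_area C normrN normr_nat divff.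
split; first by rewrite /is_triangle C; apply/eqP; rewrite oppr_eq0.
left; rewrite /Defs.edist; congr Num.sqrt.
rewrite /b /c /normal_offset /=.
by move: d0; rewrite /dist_sq => d0; field; rewrite gt_eqF.
Qed.

Lemma unbounded_far (S : set (R * R)) (D : R) : ~ ebounded S ->
  exists2 p, S p & D < Defs.edist 0 p.
Proof.
move=> nb; apply: contrapT => nfar; apply: nb; exists 0, D => p Sp.
by rewrite leNgt; apply/negP => far; apply: nfar; exists p.
Qed.

Lemma nearly_identity_id (B : set (plane R)) (eta : R) : 0 < eta ->
  nearly_identity B eta id.
Proof.
by move=> eta0; split=> [p|p q] _; rewrite ?subrr ?normr0// => _;
  rewrite subr0 normr0 divr_ge0.
Qed.

End triangles.

Theorem theorem1 (R : realType) (S : set (R * R))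
    (S_unbounded : ~ ebounded S)
    (S_measurable : lebesgue_measurable2 S)
    (S_positive : (0 < lebesgue_measure2 S)%E) :
  (exists a b c : R * R,
      [/\ S a, S b, S c, isosceles_triangle a b c & triangle_area a b c = 1])
  /\
  (exists a b c : R * R,
      [/\ S a, S b, S c, right_triangle a b c & triangle_area a b c = 1]).
Proof.
have [r [eta [eta0 ret]]] := nearly_identity_return S_measurable S_positive.
split.
- have [D1 far1] := nearly_identity_offset r 1 eta0.
  have [D2 far2] := nearly_identity_offset r (- 1) eta0.
  have [p Sp] := unbounded_far (Num.max D1 D2) S_unbounded.
  rewrite gt_max => /andP[/far1[n1 d1] /far2[n2 _]].
  have [m [mr Sc Sb]] := ret _ _ n1 n2.
  have [tri area] := isosceles_triangle_offset (d1 _ mr).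
  by exists p, (m + normal_offset (- 1) p m), (m + normal_offset 1 p m).
- have [D far] := nearly_identity_offset r 2 eta0.
  have [p Sp /far[n d]] := unbounded_far D S_unbounded.
  have [m [mr Sm Sc]] := ret _ _ (nearly_identity_id (open_box r) eta0) n.
  have [tri area] := right_triangle_offset (d _ mr).
  by exists m, p, (m + normal_offset 2 p m).
Qed.
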